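(* Let $p$ be a prime and $G=C_p$. Let $V$ and $V'$ be finite-dimensional real orthogonal representations of $G$ with $V^G=0$ and $(V')^G=0$. If $\dim(V)>\dim(V')$, then there is no $G$-equivariant continuous map $S(V)\to S(V')$.
   Context: $S(V)$ denotes the unit sphere of $V$ with the induced $G$-action. *)

(* Defs.v *)
From HB Require Import structures.
From mathcomp Require Import all_boot all_order all_algebra.
From mathcomp Require Import fingroup cyclic mxrepresentation.
From mathcomp Require Import classical_sets reals topology normedtype.

Set Implicit Arguments.
Unset Strict Implicit.
Unset Printing Implicit Defensive.

Import GRing.Theory Num.Theory.
Import numFieldNormedType.Exports.

Local Open Scope classical_set_scope.
Local Open Scope ring_scope.

(* An n-dimensional real orthogonal representation of G is a homomorphism
   from G to O(n). Vectors are rows and g acts by v |-> v *m rV g, as in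
   mxrepresentation. *)
Definition orthogonal_repr (R : realType) (gT : finGroupType) (G : {group gT})
    (n : nat) (rV : mx_representation R G n) : Prop :=
  forall g, g \in G -> rV g *m (rV g)^T = 1%:M.

(* The library norm on 'rV[R]_n is the sup norm, so the Euclidean unit sphere
   is written with the sum of squares. *)
Definition unit_sphere (R : realType) (n : nat) : set 'rV[R]_n :=
  [set v | \sum_(i < n) v 0 i ^+ 2 = 1].
Arguments unit_sphere : clear implicits.

(* A map S(V) -> S(V') is given by a function on the whole space of which only
   the restriction to S(V) matters; {within _, continuous _} is continuity for
   the subspace topology. *)
Definition equivariant_sphere_map (R : realType) (gT : finGroupType)
    (G : {group gT}) (n m : nat)
    (rV : mx_representation R G n) (rV' : mx_representation R G m)
    (f : 'rV[R]_n -> 'rV[R]_m) : Prop :=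
  [/\ {within unit_sphere R n, continuous f},
      (forall v, unit_sphere R n v -> unit_sphere R m (f v)) &
      (forall g v, g \in G -> unit_sphere R n v ->
         f (v *m rV g) = f v *m rV' g)].

(* Main.v *)
Require Import Defs.
From HB Require Import structures.
From mathcomp Require Import all_boot all_order all_algebra.
From mathcomp Require Import fingroup cyclic mxrepresentation.
From mathcomp Require Import filter classical_sets reals topology normedtype.
From mathcomp Require Import realfun sequences ring lra.

(** This is the Borsuk-Ulam theorem for C_p, proved by a discretization that
    needs no homology theory.

    Write x for a generator of G.  The source sphere is probed by the join of
    m+1 copies of C_p: for generic w_0, ..., w_m in V every choice of exponents
    makes the vectors x^(c_0) w_0, ..., x^(c_m) w_m linearly independent
    ([generic_frame]), so the simplex they span avoids 0 and can be projected
    to S(V); this is where m < n enters.  On the target side, generic linear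
    functionals l_0, ..., l_(m-1) on V' have the property that for each y <> 0
    some l_i takes p distinct values on the orbit of y
    ([separating_functionals]), because the differences x^a - x^b are
    invertible on V': the action is free away from 0.  Labelling y by the index
    i and the (negated) exponent a maximizing l_i (x^a y) is an equivariant
    labelling by 'I_m * C_p, and by compactness two nearby points with the same
    i have the same label ([argmax_label_shift], [argmax_label_close]).  An
    equivariant map S(V) -> S(V') therefore labels a fine iterated barycentric
    subdivision of the join of m+1 copies of C_p by the vertices of the join of
    m copies, simplicially and equivariantly.

    That this is impossible ([no_equivariant_labelling]) is a dimension count
    with F_p coefficients.  In the source there are chains c_n, each a cone
    over an image of the previous one, whose boundary is alternately (x - 1)
    and the norm 1 + x + ... + x^(p-1) applied to c_(n-1) ([join_chain_cobd]),
    as in the periodic resolution of C_p.  In the target the action is free, so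
    the same two operators are exact on alternating cochains ([tau_solve]), and
    starting from the constant 1 one builds alternating cochains chi_n with
    cobd chi_n = (x - 1) chi_(n+1) or norm chi_(n+1), alternately.  Stokes
    then transports the value 1 from each chi_n to the next
    ([chain_descent]).  But a simplex of the join of m copies of C_p has at
    most m distinct vertices, so the coboundary of the alternating cochain chi_m
    vanishes on the m+1 labels of a simplex: 1 = 0.

    Chains are never formed: a chain is represented by the functional it
    induces on cochains, that is, on functions of a sequence of vertices. *)

Set Implicit Arguments.
Unset Strict Implicit.
Unset Printing Implicit Defensive.

Import Order.TTheory GRing.Theory Num.Theory.
Import numFieldNormedType.Exports.

Local Open Scope classical_set_scope.
Local Open Scope ring_scope.

(** * Cochains on sequences of vertices *)

Section Cochains.
Variables (K : nzRingType) (T : eqType).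
Implicit Types (phi : seq T -> K) (s u v : seq T) (x y : T).

(** The simplicial coboundary of the augmented complex: unfolding the recursion
    gives the alternating sum of [phi] over [s] with one entry deleted. *)
Fixpoint cobd phi s : K :=
  if s is x :: s' then phi s' - cobd (fun u => phi (x :: u)) s' else 0.

Lemma eq_cobd_faces phi phi' s :
    (forall u, size u = (size s).-1 -> {subset u <= s} -> phi u = phi' u) ->
  cobd phi s = cobd phi' s.
Proof.
elim: s phi phi' => [//|x s IHs] phi phi' eq_phi /=.
rewrite eq_phi // => [|y ys]; last by rewrite inE ys orbT.
congr (_ - _); case: s IHs eq_phi => [//|y s] IHs eq_phi.
apply: IHs => u szu sub_us; apply: eq_phi => [|z]; first by rewrite /= szu.
by rewrite !(in_cons x) => /orP[->|/sub_us ->] //; rewrite orbT.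
Qed.

Lemma eq_cobd phi phi' s : phi =1 phi' -> cobd phi s = cobd phi' s.
Proof. by move=> eq_phi; apply: eq_cobd_faces => u _ _. Qed.

Lemma cobdB phi phi' s :
  cobd (fun u => phi u - phi' u) s = cobd phi s - cobd phi' s.
Proof.
elim: s phi phi' => [|x s IHs] phi phi' /=; first by rewrite subr0.
by rewrite IHs !opprD !opprK addrACA.
Qed.

Lemma cobd0 s : cobd (fun=> 0) s = 0.
Proof. by elim: s => //= x s ->; rewrite subr0. Qed.

Lemma cobd_sum n (F : nat -> seq T -> K) s :
  cobd (fun u => \sum_(a < n) F a u) s = \sum_(a < n) cobd (F a) s.
Proof.
elim: s F => [|x s IHs] F /=; first by rewrite big1.
by rewrite (IHs (fun a u => F a (x :: u))) -sumrB.
Qed.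

Lemma cobd_cobd phi s : cobd (cobd phi) s = 0.
Proof.
elim: s phi => [//|x s IHs] phi /=.
by rewrite cobdB IHs subr0 subrr.
Qed.

End Cochains.

Lemma cobd_map (K : nzRingType) (T T' : eqType) (f : T -> T')
    (phi : seq T' -> K) s :
  cobd (fun u => phi (map f u)) s = cobd phi (map f s).
Proof. by elim: s phi => //= x s IHs phi; rewrite -IHs. Qed.

(** * Barycentric subdivision *)

Section Subdivision.
Variables (K : nzRingType) (T : eqType) (b : seq T -> T).
Implicit Types (phi : seq T -> K) (s u v : seq T) (x y : T).

(** The dual of the subdivision operator on chains, which sends a simplex to the
    cone from its barycentre [b s] over the subdivision of its boundary.  The
    counter [n] is meant to be [size s]. *)
Fixpoint subdiv n phi s : K :=
  if n is n'.+1 then cobd (subdiv n' (fun u => phi (b s :: u))) s else phi s.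

Lemma eq_subdiv n phi phi' s : size s = n ->
    (forall u, size u = n -> phi u = phi' u) ->
  subdiv n phi s = subdiv n phi' s.
Proof.
elim: n phi phi' s => [|n IHn] phi phi' s szs eq_phi /=; first exact: eq_phi.
apply: eq_cobd_faces => u szu _.
apply: IHn => [|v szv]; first by rewrite szu szs.
by apply: eq_phi; rewrite /= szv.
Qed.

Lemma subdivB n phi phi' s :
  subdiv n (fun u => phi u - phi' u) s = subdiv n phi s - subdiv n phi' s.
Proof.
elim: n phi phi' s => [//|n IHn] phi phi' s /=.
by rewrite -cobdB; apply: eq_cobd => u; apply: IHn.
Qed.

Lemma subdiv_sum n k (F : nat -> seq T -> K) s :
  subdiv n (fun u => \sum_(a < k) F a u) s = \sum_(a < k) subdiv n (F a) s.
Proof.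
elim: n F s => [//|n IHn] F s /=.
rewrite -(cobd_sum _ (fun a => subdiv n (fun v => F a (b s :: v)))).
by apply: eq_cobd => u; apply: (IHn (fun a v => F a (b s :: v))).
Qed.

(** Since the boundary of a cone over z is z minus the cone over the boundary of
    z, this follows by induction from the vanishing of [cobd (cobd _)]. *)
Lemma subdiv_cobd n phi s : size s = n.+1 ->
  subdiv n.+1 (cobd phi) s = cobd (subdiv n phi) s.
Proof.
elim: n phi s => [|n IHn] phi s szs.
  by case: s szs => [|x []] //= _; rewrite subr0.
transitivity (cobd (fun u => subdiv n.+1 phi u
   - cobd (subdiv n (fun v => phi (b s :: v))) u) s).
  apply: eq_cobd_faces => u; rewrite szs => szu _.
  by rewrite -(IHn (fun v => phi (b s :: v))) // -subdivB.
by rewrite cobdB cobd_cobd subr0.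
Qed.

Lemma subdiv_map n (g : T -> T) phi s :
    (forall u, b (map g u) = g (b u)) ->
  subdiv n (fun u => phi (map g u)) s = subdiv n phi (map g s).
Proof.
move=> bg; elim: n phi s => [//|n IHn] phi s /=.
by rewrite bg -cobd_map; apply: eq_cobd => u; rewrite -IHn.
Qed.

Definition iter_subdiv r n := iter r (subdiv n).

Lemma iter_subdiv_cobd r n phi s : size s = n.+1 ->
  iter_subdiv r n.+1 (cobd phi) s = cobd (iter_subdiv r n phi) s.
Proof.
rewrite /iter_subdiv; elim: r s => [//|r IHr] s szs; rewrite !iterS.
by rewrite -subdiv_cobd //; apply: eq_subdiv.
Qed.

Lemma iter_subdiv_map r n (g : T -> T) phi s :
    (forall u, b (map g u) = g (b u)) -> size s = n ->
  iter_subdiv r n (fun u => phi (map g u)) s = iter_subdiv r n phi (map g s).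
Proof.
move=> bg; rewrite /iter_subdiv; elim: r s => [//|r IHr] s szs; rewrite !iterS.
by rewrite -subdiv_map //; apply: eq_subdiv => // u; apply: IHr.
Qed.

Lemma iter_subdivB r n phi phi' s : size s = n ->
  iter_subdiv r n (fun u => phi u - phi' u) s =
  iter_subdiv r n phi s - iter_subdiv r n phi' s.
Proof.
rewrite /iter_subdiv; elim: r s => [//|r IHr] s szs; rewrite !iterS.
by rewrite -subdivB; apply: eq_subdiv.
Qed.

Lemma iter_subdiv_sum r n k (F : nat -> seq T -> K) s : size s = n ->
  iter_subdiv r n (fun u => \sum_(a < k) F a u) s =
  \sum_(a < k) iter_subdiv r n (F a) s.
Proof.
rewrite /iter_subdiv; elim: r s => [//|r IHr] s szs; rewrite !iterS.
by rewrite -(subdiv_sum _ _ (fun a => iter r _ (F a))); apply: eq_subdiv.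
Qed.

End Subdivision.

(** * The periodic resolution and chains on a join *)

Section CyclicOperators.
Variables (K : nzRingType) (T : eqType) (p : nat) (g : T -> T).
Hypothesis gp : iter p g =1 id.
Implicit Types (phi : seq T -> K) (s u v : seq T).

Definition act_diff phi s := phi (map g s) - phi s.
Definition act_norm phi s := \sum_(a < p) phi (map (iter a g) s).

(** The differentials of the periodic resolution of C_p, preceded by the
    identity in degree 0: there the empty simplex is the boundary of a single
    vertex. *)
Definition tau n phi s :=
  if n is n'.+1 then (if odd n' then act_norm phi s else act_diff phi s)
  else phi s.

Lemma map_iter0 s : map (iter 0 g) s = s.
Proof. exact: map_id. Qed.

Lemma map_iterp s : map (iter p g) s = s.
Proof. by rewrite (eq_map gp) map_id. Qed.

Lemma map_iterS a s : map (iter a g) (map g s) = map (iter a.+1 g) s.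
Proof. by rewrite -map_comp; apply: eq_map => x /=; rewrite -iterSr. Qed.

Lemma act_diff_act_norm phi s : act_diff (act_norm phi) s = 0.
Proof.
rewrite /act_diff /act_norm -sumrB; under eq_bigr do rewrite map_iterS.
rewrite -(big_mkord xpredT (fun a => phi (map (iter a.+1 g) s) -
                                       phi (map (iter a g) s))).
rewrite (telescope_sumr (fun a => phi (map (iter a g) s))) //.
by rewrite map_iterp map_iter0 subrr.
Qed.

Lemma act_norm_act_diff phi s : act_norm (act_diff phi) s = 0.
Proof.
rewrite -(act_diff_act_norm phi s) /act_diff /act_norm -sumrB.
apply: eq_bigr => a _; rewrite -!map_comp; congr (phi _ - _).
by apply: eq_map => x /=; rewrite -iterSr.
Qed.

Lemma tau_tau n phi s : tau n.+1 (tau n.+2 phi) s = 0.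
Proof.
rewrite /tau /=; case: (odd n); first exact: act_norm_act_diff.
exact: act_diff_act_norm.
Qed.

Lemma tauSS n phi s : tau n.+3 phi s = tau n.+1 phi s.
Proof. by rewrite /tau /= negbK. Qed.

(** This replaces [tau_tau] in degree 0.  On the empty simplex the norm is
    multiplication by p, so that characteristic p is essential. *)
Lemma tau_nil n phi : p%:R = 0 :> K -> tau n.+1 phi [::] = 0.
Proof.
move=> p0; rewrite /tau /act_norm /act_diff /=.
case: ifP => _; last by rewrite subrr.
by rewrite big_const_ord iter_addr_0 -mulr_natr p0 mulr0.
Qed.

Lemma eq_tau n phi phi' s :
    (forall a, phi (map (iter a g) s) = phi' (map (iter a g) s)) ->
  tau n phi s = tau n phi' s.
Proof.
move=> eq_phi; have e0 : phi s = phi' s.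
  by have:= eq_phi 0; rewrite map_iter0.
case: n => //= n; case: ifP => _; first exact: eq_bigr.
by rewrite /act_diff e0; have := eq_phi 1 => /= ->.
Qed.

Lemma tauB n phi phi' s :
  tau n (fun u => phi u - phi' u) s = tau n phi s - tau n phi' s.
Proof.
case: n => //= n; case: ifP => _; first by rewrite /act_norm sumrB.
by rewrite /act_diff !opprD !opprK addrACA.
Qed.

Lemma cobd_tau n phi s : cobd (tau n phi) s = tau n (cobd phi) s.
Proof.
case: n => [//|n]; rewrite /tau; case: (odd n).
  rewrite [LHS](cobd_sum _ (fun a u => phi (map (iter a g) u))).
  by apply: eq_bigr => a _; exact: cobd_map.
by rewrite [LHS]cobdB cobd_map.
Qed.

Lemma iter_subdiv_tau (b : seq T -> T) r k n phi s :
    (forall u, b (map g u) = g (b u)) -> size s = k ->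
  iter_subdiv b r k (tau n phi) s = tau n (iter_subdiv b r k phi) s.
Proof.
move=> bg szs; have bga a u : b (map (iter a g) u) = iter a g (b u).
  elim: a => [|a IHa]; first by rewrite map_iter0.
  by rewrite /= -IHa -bg -map_comp.
case: n => [//|n]; rewrite /tau; case: (odd n).
  rewrite [LHS](iter_subdiv_sum _ _ _ (fun a u => phi (map (iter a g) u))) //.
  by apply: eq_bigr => a _; apply: iter_subdiv_map.
by rewrite [LHS]iter_subdivB // iter_subdiv_map.
Qed.

Variable w : nat -> T.

(** Evaluation of [phi] on the chain c_n of the join of n copies of C_p, where
    c_(n+1) is the cone from [w n] over the image of c_n under [tau n]. *)
Fixpoint join_chain n phi : K :=
  if n is n'.+1 then join_chain n' (tau n' (fun u => phi (w n' :: u)))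
  else phi [::].

(** The simplices of size n of the join; those with [c] bounded by the period
    support [join_chain n]. *)
Fixpoint join_simplex n (c : nat -> nat) : seq T :=
  if n is n'.+1 then iter (c n') g (w n') :: join_simplex n' c else [::].

Lemma size_join_simplex n c : size (join_simplex n c) = n.
Proof. by elim: n => //= n ->. Qed.

Lemma join_simplex_map n c a :
  map (iter a g) (join_simplex n c) = join_simplex n (fun i => a + c i)%N.
Proof. by elim: n => //= n ->; rewrite iterD. Qed.

Lemma eq_join_simplex n c c' : (forall i, (i < n)%N -> c i = c' i) ->
  join_simplex n c = join_simplex n c'.
Proof.
elim: n => //= n IHn eqc; rewrite eqc // IHn // => i /ltnW lti; exact: eqc.
Qed.

Lemma eq_join_chain n phi phi' :
    (forall c, phi (join_simplex n c) = phi' (join_simplex n c)) ->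
  join_chain n phi = join_chain n phi'.
Proof.
elim: n phi phi' => [|n IHn] phi phi' eq_phi /=; first exact: (eq_phi id).
apply: IHn => c; apply: eq_tau => a; rewrite join_simplex_map.
(* The apex occurs with exponent 0, the rest is translated by a. *)
have := eq_phi (fun i => if i == n then 0 else a + c i)%N.
rewrite /= eqxx /= (eq_join_simplex (c' := fun i => a + c i)%N) // => i lti.
by rewrite ltn_eqF.
Qed.

Lemma join_chainB n phi phi' :
  join_chain n (fun u => phi u - phi' u) = join_chain n phi - join_chain n phi'.
Proof.
elim: n phi phi' => [//|n IHn] phi phi' /=.
by rewrite -IHn; apply: eq_join_chain => c; rewrite tauB.
Qed.

Lemma join_chain0 n : join_chain n (fun=> 0) = 0.
Proof.
rewrite -[RHS](subrr (join_chain n (fun=> 0))) -join_chainB.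
by apply: eq_join_chain => c; rewrite subrr.
Qed.

(** Stokes for c_(n+1): the boundary of the cone is its base minus the cone over
    the boundary of the base, and the latter is zero because consecutive
    differentials [tau] compose to zero. *)
Lemma join_chain_cobd n phi : p%:R = 0 :> K ->
  join_chain n.+1 (cobd phi) = join_chain n (tau n phi).
Proof.
move=> p0; elim: n phi => [|n IHn] phi; first by rewrite /= subr0.
transitivity (join_chain n.+1 (fun u => tau n.+1 phi u
    - cobd (tau n.+1 (fun v => phi (w n.+1 :: v))) u)).
  apply: (eq_join_chain (n := n.+1)) => c.
  by rewrite cobd_tau -tauB.
rewrite join_chainB IHn [X in _ - X](eq_join_chain (phi' := fun=> 0)) => [|c].
  by rewrite join_chain0 subr0.
by case: n {IHn} c => [|n] c; [exact: tau_nil | exact: tau_tau].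
Qed.

End CyclicOperators.

(** * Alternating cochains on labels *)

Lemma ltn_Fp p (a : 'F_p) : prime p -> (a < p)%N.
Proof. by move=> p_pr; rewrite -[X in (_ < X)%N](Fp_cast p_pr). Qed.

Section Labels.
Variable (p : nat).
Hypothesis p_pr : prime p.
Local Notation T := (nat * 'F_p)%type.
Local Notation K := 'F_p.
Implicit Types (phi chi : seq T -> K) (s u v : seq T) (S : pred T).

Definition shift (x : T) : T := (x.1, x.2 + 1).

Lemma iter_shift a x : iter a shift x = (x.1, x.2 + a%:R).
Proof.
elim: a => [|a /= ->]; first by rewrite addr0; case: x.
by rewrite /shift /= -addrA natr1.
Qed.

Lemma natr_Fp0 : p%:R = 0 :> K.
Proof. by apply/eqP; rewrite -(dvdn_pcharf (pchar_Fp p_pr)). Qed.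

Lemma iter_shift_p : iter p shift =1 id.
Proof. by move=> x; rewrite iter_shift natr_Fp0 addr0; case: x. Qed.

(** The simplices of the join of countably many copies of C_p: a set of labels
    spans one when it contains at most one vertex of each copy. *)
Definition transverse S := {in S &, forall x y, x.1 = y.1 -> x = y}.

(** Both conditions only concern simplices.  They are stated relative to a
    transverse set [S] that contains all the entries, so that they pass from
    [phi] to [fun s => phi (x :: s)] for [x] in [S]. *)
Definition alternating phi := forall S, transverse S ->
  (forall u x y v, all S (u ++ [:: x, y & v]) ->
     phi (u ++ [:: x, y & v]) = - phi (u ++ [:: y, x & v])) /\
  (forall u x v, all S (u ++ [:: x, x & v]) -> phi (u ++ [:: x, x & v]) = 0).

(** Deleting either one of two adjacent entries contributes with opposite signs,
    so the two terms are exchanged by a swap and cancel when the entries agree;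
    in all other terms both entries remain. *)
Lemma alternating_cobd phi : alternating phi -> alternating (cobd phi).
Proof.
move=> alt S trS; have {alt} [sw eq] := alt S trS; split.
  move=> u; elim: u phi sw eq => [|z u IHu] phi sw eq x y v /=.
    case/and3P=> Sx Sy Sv.
    rewrite (eq_cobd_faces (phi' := fun u => 0 - phi [:: y, x & u]))
      => [|u szu us].
      by rewrite cobdB cobd0; ring.
    rewrite sub0r; apply: (sw [::]) => /=; rewrite Sx Sy.
    by apply/allP => z /us; apply/allP.
  case/andP=> Sz Su; rewrite IHu //.
  - by rewrite (sw u) //; ring.
  - by move=> u' x' y' v' Su'; apply: (sw (z :: u')); rewrite /= Sz.
  - by move=> u' x' v' Su'; apply: (eq (z :: u')); rewrite /= Sz.
move=> u; elim: u phi sw eq => [|z u IHu] phi sw eq x v /=.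
  case/and3P=> Sx _ Sv.
  rewrite (eq_cobd_faces (phi' := fun=> 0)) => [|u szu us].
    by rewrite cobd0; ring.
  apply: (eq [::]) => /=; rewrite Sx /=.
  by apply/allP => z /us; apply/allP.
case/andP=> Sz Su; rewrite IHu //.
- by rewrite (eq u) //; ring.
- by move=> u' x' y' v' Su'; apply: (sw (z :: u')); rewrite /= Sz.
- by move=> u' x' v' Su'; apply: (eq (z :: u')); rewrite /= Sz.
Qed.

(** A repeated entry can be moved next to its copy, at the cost of a sign. *)
Lemma alternating_nonuniq phi S s : alternating phi -> transverse S ->
  all S s -> ~~ uniq s -> phi s = 0.
Proof.
move=> alt trS; have {alt} [sw eq] := alt S trS.
have dup u a x b : all S (u ++ x :: a ++ x :: b) ->
    phi (u ++ x :: a ++ x :: b) = 0.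
  elim: a u => [|y a IHa] u; first exact: eq.
  move=> Sall; rewrite sw // -cat_rcons IHa ?oppr0 //.
  by move: Sall; rewrite cat_rcons !all_cat /= => /and4P[-> -> -> ->].
suff main u : all S (u ++ s) -> ~~ uniq s -> phi (u ++ s) = 0.
  exact: (main [::]).
elim: s u => [//|x s IHs] u Ss /=; rewrite negb_and negbK => /orP[xs|].
  by case/splitPr: xs Ss => a b; apply: dup.
by rewrite -cat_rcons; apply: IHs; rewrite cat_rcons.
Qed.

(** The C_p-coordinate of the entry that lies in the copy of smallest index.
    This is an equivariant and permutation invariant map from simplices to C_p,
    hence a trivialization of the free action. *)
Definition phase s : K :=
  (head (0, 0) (sort (fun x y : T => (x.1 <= y.1)%N) s)).2.

Lemma phase_shift a s : s != [::] ->
  phase (map (iter a shift) s) = phase s + a%:R.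
Proof.
move=> s0; rewrite /phase -(map_sort (leT' := fun x y => x.1 <= y.1)%N);
  last by move=> x y; rewrite !iter_shift.
case: (sort _ s) (size_sort (fun x y : T => (x.1 <= y.1)%N) s) s0 => [|x t] /=.
  by case: s.
by rewrite iter_shift.
Qed.

Lemma phase_perm S s s' : transverse S -> all S s -> perm_eq s s' ->
  phase s = phase s'.
Proof.
move=> trS /allP Ss ss'; congr (head _ _).2; apply/perm_sort_inP => //.
- by move=> x y _ _; apply: leq_total.
- by move=> x y z _ _ _; apply: leq_trans.
- by move=> x y xs ys; rewrite -eqn_leq => /eqP; apply: trS; apply: Ss.
Qed.

Lemma phase_swap S u x y v : transverse S -> all S (u ++ [:: x, y & v]) ->
  phase (u ++ [:: x, y & v]) = phase (u ++ [:: y, x & v]).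
Proof.
move=> trS Ss; apply: phase_perm trS Ss _; rewrite perm_cat2l.
exact: (permEl (perm_catCA [:: x] [:: y] v)).
Qed.

(** The translate of [S] by -a; the exponent p.-1 * a stands for -a modulo p. *)
Lemma transverse_shift S a : transverse S ->
  transverse (fun x => S (iter (p.-1 * a) shift x)).
Proof.
move=> trS x y Sx Sy xy; have /= := trS _ _ Sx Sy.
rewrite !iter_shift /= => /(_ xy) /(congr1 snd) /= /addIr.
by case: x y xy {Sx Sy} => [x1 x2] [y1 y2] /= <- <-.
Qed.

Lemma all_shift S a s : all S s ->
  all (fun x => S (iter (p.-1 * a) shift x)) (map (iter a shift) s).
Proof.
move=> Ss; rewrite all_map; apply: sub_all Ss => x /=.
rewrite !iter_shift /= -addrA -natrD -mulSn prednK ?prime_gt0 //.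
by rewrite natrM natr_Fp0 mul0r addr0; case: x.
Qed.

Lemma alternating_shift a phi : alternating phi ->
  alternating (fun s => phi (map (iter a shift) s)).
Proof.
move=> alt S trS; have [sw eq] := alt _ (transverse_shift (a := a) trS).
split=> [u x y v /(all_shift a)|u x v /(all_shift a)]; rewrite !map_cat /=.
  exact: sw.
exact: eq.
Qed.

(** A cochain killed by the norm is of the form (x - 1) chi: sum [phi] along the
    orbit, from the translate of phase 0 up to the given simplex.  The norm
    condition is what makes this sum consistent when the phase wraps around. *)
Lemma alternating_act_diff_solve phi : alternating phi ->
  exists2 chi, alternating chi & forall s, s != [::] ->
    act_norm p shift phi s = 0 -> act_diff shift chi s = phi s.
Proof.
(* The translate of s by p - phase s + l has phase l. *)
move=> alt; pose chi s :=
  \sum_(l < phase s) phi (map (iter (p - phase s + l) shift) s).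
exists chi.
  move=> S trS; split=> [u x y v Sall | u x v Sall]; rewrite /chi.
    rewrite (phase_swap trS Sall) -sumrN; apply: eq_bigr => l _.
    exact: (alternating_shift _ alt trS).1.
  by apply: big1 => l _; apply: (alternating_shift _ alt trS).2.
move=> s s0 nrm0; rewrite /act_diff /chi.
have -> : phase (map shift s) = phase s + 1.
  by have := phase_shift 1 s0 => /= <-; congr phase; apply: eq_map.
under eq_bigr do rewrite map_iterS.
have lek : (phase s < p)%N := ltn_Fp _ p_pr.
have valS : (phase s + 1)%R = ((phase s).+1 %% p)%N :> nat.
  by rewrite -{1}[phase s]natr_Zp natr1 val_Fp_nat.
rewrite valS; move: (nat_of_ord _) lek => k.
rewrite leq_eqVlt => /orP[/eqP k1p | ltk].
  rewrite k1p modnn big_ord0 sub0r.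
  have -> : (p - k = 1)%N by rewrite -k1p subSnn.
  move: nrm0; rewrite /act_norm.
  rewrite -(big_mkord xpredT (fun a => phi (map (iter a shift) s))).
  rewrite -[X in index_iota _ X]k1p big_mkord big_ord_recl map_iter0.
  by move/eqP; rewrite addr_eq0 => /eqP ->.
rewrite modn_small //.
have ltkp := ltnW ltk; under eq_bigr do rewrite -addSn subnSK //.
rewrite big_ord_recr /= subnK; last exact: ltnW.
by rewrite (map_iterp iter_shift_p) addrAC subrr add0r.
Qed.

(** An invariant cochain is the norm of its restriction to simplices of
    phase 0. *)
Lemma alternating_act_norm_solve phi : alternating phi ->
  exists2 chi, alternating chi & forall s, s != [::] ->
    (forall a, phi (map (iter a shift) s) = phi s) ->
    act_norm p shift chi s = phi s.
Proof.
move=> alt; exists (fun s => (phase s == 0)%:R * phi s).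
  move=> S trS; split=> [u x y v Sall | u x v Sall].
    by rewrite (phase_swap trS Sall) (alt _ trS).1 // mulrN.
  by rewrite (alt _ trS).2 // mulr0.
move=> s s0 phi_s; rewrite /act_norm.
under eq_bigr do rewrite phi_s phase_shift //.
pose a0 := Ordinal (ltn_Fp (- phase s) p_pr).
have a0E : (a0 : nat)%:R = - phase s by exact: natr_Zp.
rewrite (bigD1 a0) // a0E subrr eqxx mul1r big1 => [|a]; first exact: addr0.
case: (eqVneq (phase s + _)) => [phase_a|]; last by rewrite mul0r.
case/eqP; apply: val_inj.
have: a%:R = a0%:R :> K.
  by rewrite a0E; apply/eqP; rewrite -addr_eq0 addrC phase_a.
move/(congr1 (@nat_of_ord _)).
by rewrite !val_Fp_nat // !modn_small ?ltn_ord.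
Qed.

(** Exactness of the periodic complex on alternating cochains: the kernel
    of [tau n.+2] is contained in the image of [tau n.+1]. *)
Lemma tau_solve n phi : alternating phi ->
    (forall (s : seq T) (S : pred T), transverse S -> all S s ->
       size s = n.+1 -> tau p shift n.+2 phi s = 0) ->
  exists2 chi, alternating chi &
    forall (s : seq T) (S : pred T), transverse S -> all S s ->
    size s = n.+1 -> tau p shift n.+1 chi s = phi s.
Proof.
move=> alt phi0; case en: (odd n).
  have [chi alt_chi chiP] := alternating_act_norm_solve alt.
  exists chi => // s S trS Ss szs.
  rewrite /tau en chiP //; first by case: s szs {Ss}.
  have step S' s' : transverse S' -> all S' s' -> size s' = n.+1 ->
      phi (map shift s') = phi s'.
    move=> trS' Ss' szs'; apply/eqP; rewrite -subr_eq0.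
    by have := phi0 s' S' trS' Ss' szs'; rewrite /tau /= en /= /act_diff => ->.
  elim=> [|a IHa]; first by rewrite map_iter0.
  rewrite -IHa -[RHS](step _ _ (transverse_shift (a := a) trS)) ?size_map //.
    by rewrite -map_comp.
  exact: all_shift.
have [chi alt_chi chiP] := alternating_act_diff_solve alt.
exists chi => // s S trS Ss szs.
rewrite /tau en chiP //; first by case: s szs {Ss}.
by have := phi0 s S trS Ss szs; rewrite /tau /= en.
Qed.

(** * Equivariant labellings of a subdivided join *)

Section Labelling.
Variables (T0 : eqType) (g : T0 -> T0) (b : seq T0 -> T0) (w : nat -> T0).
Variables (lam : T0 -> T) (m r : nat).
Hypothesis gp : iter p g =1 id.
Hypothesis bg : forall s : seq T0, b (map g s) = g (b s).

(** On the simplex [u] the labelling is equivariant and simplicial, with values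
    in the join of m copies of C_p. *)
Definition labelled (u : seq T0) :=
  (forall x, x \in u -> ((lam x).1 < m)%N /\
     forall a, lam (iter a g x) = iter a shift (lam x)) /\
  {in u &, forall x y, (lam x).1 = (lam y).1 -> lam x = lam y}.

(* Every simplex of the r-th subdivision of the join is labelled: stated through
   cochains, which only see the simplices that occur in the subdivision. *)
Hypothesis lam_loc : forall n c (phi phi' : seq T0 -> K), (n <= m.+1)%N ->
    (forall u : seq T0, size u = n -> labelled u -> phi u = phi' u) ->
  iter_subdiv b r n phi (join_simplex g w n c) =
  iter_subdiv b r n phi' (join_simplex g w n c).

Local Notation chain n phi := (join_chain p g w n (iter_subdiv b r n phi)).

Lemma chain_cobd n (phi : seq T0 -> K) :
  chain n.+1 (cobd phi) = chain n (tau p g n phi).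
Proof.
rewrite (eq_join_chain p (phi' := cobd (iter_subdiv b r n phi))) => [|c].
  rewrite (join_chain_cobd gp) ?natr_Fp0 //; apply: (eq_join_chain p) => c.
  by rewrite (iter_subdiv_tau p _ _ _ bg) ?size_join_simplex.
by rewrite iter_subdiv_cobd ?size_join_simplex.
Qed.

(** The coboundary of [chi], a cochain of degree n, pairs to 1 with the
    pushforward of c_(n+1): since this coboundary is [tau n.+1] of the next
    cochain, Stokes moves the pairing up by one degree.  The middle condition is
    what allows the next cochain to be constructed by [tau_solve]. *)
Lemma chain_descent n : (n <= m)%N -> exists chi,
  [/\ alternating chi,
      forall (s : seq T) (S : pred T), transverse S -> all S s ->
        size s = n.+1 -> tau p shift n.+2 (cobd chi) s = 0 &
      chain n.+1 (fun u : seq T0 => cobd chi (map lam u)) = 1].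
Proof.
elim: n => [|n IHn] lt_nm.
  exists (fun s => (s == [::])%:R); split.
  - by move=> S _; split=> [[|z u] x y v|[|z u] x v] //= _; rewrite oppr0.
  - move=> s S _ _; case: s => [|x []] //= _; rewrite /act_norm /= subr0.
    by rewrite sumr_const card_ord natr_Fp0.
  - rewrite (eq_join_chain p (phi' := iter_subdiv b r 1
      (cobd (fun s : seq T0 => (s == [::])%:R)))).
      by rewrite chain_cobd /=; elim: (r).
    move=> c; apply: lam_loc => // u szu _.
    by rewrite -cobd_map; apply: eq_cobd; case.
have [chi [alt_chi tau_chi chain_chi]] := IHn (ltnW lt_nm).
have [psi alt_psi psiP] := tau_solve (alternating_cobd alt_chi) tau_chi.
exists psi; split=> // [s S trS Ss szs|].
  rewrite -cobd_tau (eq_cobd_faces (phi' := cobd chi)) ?cobd_cobd //.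
  move=> u szu us; rewrite tauSS; apply: (psiP _ S) => //.
    by apply/allP => x /us; apply/allP.
  by rewrite szu szs.
rewrite (eq_join_chain p (phi' := iter_subdiv b r n.+2
    (cobd (fun u : seq T0 => psi (map lam u))))).
  rewrite chain_cobd -chain_chi; apply: (eq_join_chain p) => c.
  apply: lam_loc => [|u szu [labu tru]]; first exact: leqW.
  rewrite -(psiP (map lam u) (mem (map lam u))) ?size_map //; last first.
  - by move=> _ _ /mapP[x xu ->] /mapP[y yu ->]; apply: tru.
  rewrite /tau; case: ifP => _.
    rewrite /act_norm; apply: eq_bigr => a _; congr psi; rewrite -!map_comp.
    by apply/eq_in_map => x /labu[_ lam_a] /=; rewrite lam_a.
  rewrite /act_diff; congr (psi _ - _); rewrite -!map_comp.
  by apply/eq_in_map => x /labu[_ /(_ 1)].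
by move=> c; apply: lam_loc => // u szu _; rewrite cobd_map.
Qed.

(** In degree m the coboundary of an alternating cochain is evaluated on m+1
    labels from m copies of C_p, which must repeat. *)
Theorem no_equivariant_labelling : False.
Proof.
have [chi [alt_chi _ /eqP]] := chain_descent (leqnn m); apply/negP.
rewrite (eq_join_chain p (phi' := fun=> 0)).
  by rewrite join_chain0 eq_sym oner_eq0.
(* By additivity, 0 as a difference makes the subdivided zero cochain vanish. *)
move=> c.
rewrite (lam_loc c (phi' := fun _ => 0 - 0)) => [||u szu [labu tru]] //.
  by rewrite iter_subdivB ?size_join_simplex ?subrr.
rewrite subrr; apply: (alternating_nonuniq (alternating_cobd alt_chi)
  (S := mem (map lam u))).
- by move=> _ _ /mapP[x xu ->] /mapP[y yu ->]; apply: tru.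
- exact/allP.
apply/negP => uniq_u; suff: (size (map fst (map lam u)) <= size (iota 0 m))%N.
  by rewrite !size_map size_iota szu ltnn.
apply: uniq_leq_size.
  rewrite map_inj_in_uniq //.
  by move=> _ _ /mapP[x xu ->] /mapP[y yu ->]; apply: tru.
move=> _ /mapP[_ /mapP[x xu ->] ->]; rewrite mem_iota /=.
by case: (labu x xu).
Qed.

End Labelling.
End Labels.

(** * Mesh of the iterated subdivision *)

Section Barycentre.
Variables (R : realType) (V : normedModType R).
Implicit Types (s u : seq V) (x y z : V) (X : V -> Prop) (d : R).

Definition bary s : V := (size s)%:R^-1 *: \sum_(x <- s) x.

(** Closure under barycentres of finite families is all that subdivision
    requires of a convex set. *)
Definition bary_closed X := forall s, s != [::] ->
  (forall x, x \in s -> X x) -> X (bary s).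

Definition mesh_le s d := {in s &, forall x y, `|x - y| <= d}.

Lemma bary_subE s z : s != [::] ->
  bary s - z = (size s)%:R^-1 *: \sum_(x <- s) (x - z).
Proof.
move=> s0; rewrite sumrB scalerBr big_const_seq count_predT iter_addr_0.
rewrite -[z *+ _]scaler_nat scalerA mulVf ?scale1r //.
by rewrite pnatr_eq0 size_eq0.
Qed.

(** The term of [x] itself contributes 0 to the average of the differences; this
    gains the factor 1 - 1/N. *)
Lemma bary_dist s x d N : (size s <= N)%N -> mesh_le s d -> x \in s ->
  `|x - bary s| <= (1 - N%:R^-1) * d.
Proof.
move=> sN sd xs; have s0 : s != [::] by case: s xs {sN sd}.
have sz0 : (0 < size s)%N by rewrite lt0n size_eq0.
have d0 : 0 <= d by apply: le_trans (sd x x xs xs).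
rewrite distrC bary_subE // normrZ ger0_norm ?invr_ge0 ?ler0n //.
have le_sum : `|\sum_(y <- s) (y - x)| <= (size s)%:R * d - d.
  rewrite (big_rem x) //= subrr add0r; apply: le_trans (ler_norm_sum _ _ _) _.
  have -> : (size s)%:R * d - d = \sum_(y <- rem x s) d.
    rewrite big_const_seq count_predT iter_addr_0 size_rem // -subn1.
    by rewrite mulrnBr // mulr_natl mulr1n.
  rewrite big_seq [leRHS]big_seq; apply: ler_sum => y /mem_rem ys; exact: sd.
apply: le_trans (ler_wpM2l _ le_sum) _; first by rewrite invr_ge0 ler0n.
rewrite mulrBr mulrA mulVf ?pnatr_eq0 -?lt0n // mulrBl lerD2l lerN2.
rewrite ler_wpM2r // lef_pV2 ?posrE ?ltr0n ?ler_nat //.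
exact: leq_trans sN.
Qed.

Lemma bary_closed_ball z d : bary_closed (fun x => `|x - z| <= d).
Proof.
move=> s s0 sz; have sz0 : (0 < size s)%N by rewrite lt0n size_eq0.
rewrite bary_subE // normrZ ger0_norm ?invr_ge0 ?ler0n //.
rewrite ler_pdivrMl ?ltr0n //; apply: le_trans (ler_norm_sum _ _ _) _.
have -> : (size s)%:R * d = \sum_(y <- s) d.
  by rewrite big_const_seq count_predT iter_addr_0 mulr_natl.
by rewrite big_seq [leRHS]big_seq; apply: ler_sum.
Qed.

Lemma bary_closedI X Y : bary_closed X -> bary_closed Y ->
  bary_closed (fun x => X x /\ Y x).
Proof.
by move=> bX bY s s0 sXY; split; [apply: bX | apply: bY] => // x /sXY[].
Qed.

(** Subdividing a simplex stays inside every convex set containing it and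
    shrinks the diameter by 1 - 1/N. In the induction, the ball around the
    barycentre is added to the convex set: it contains the faces, hence their
    subdivisions, so every new simplex remains close to the apex. *)
Lemma eq_subdiv_mesh (K : nzRingType) N n X d (phi phi' : seq V -> K) s :
    bary_closed X -> (size s = n) -> (n <= N)%N ->
    (forall x, x \in s -> X x) -> mesh_le s d ->
    (forall u, size u = n -> (forall x, x \in u -> X x) ->
       mesh_le u ((1 - N%:R^-1) * d) -> phi u = phi' u) ->
  subdiv bary n phi s = subdiv bary n phi' s.
Proof.
elim: n X phi phi' s => [|n IHn] X phi phi' s bX szs nN sX sd eq_phi /=.
  by case: s szs sX sd => // _ sX sd; apply: eq_phi.
have s0 : s != [::] by case: s szs {sX sd}.
apply: eq_cobd_faces => u; rewrite szs => szu us.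
apply: (IHn (fun x => X x /\ `|x - bary s| <= (1 - N%:R^-1) * d)) => //.
- by apply: bary_closedI => //; apply: bary_closed_ball.
- exact: ltnW.
- move=> x /us xs; split; first exact: sX.
  by apply: bary_dist => //; rewrite szs.
- by move=> x y /us xs /us ys; apply: sd.
move=> v szv vX vd; apply: eq_phi => [|x|x y]; first by rewrite /= szv.
  by rewrite inE => /predU1P[->|/vX[]//]; apply: bX.
rewrite !inE => /predU1P[->|xv] /predU1P[->|yv].
- rewrite subrr normr0; case: s s0 szs sd {sX us vX} => // z s _ szs sd.
  have := sd z z; rewrite inE eqxx subrr normr0 => /(_ isT isT) d0.
  by rewrite mulr_ge0 // subr_ge0 invf_le1 ?ltr0n ?ler1n // (leq_trans _ nN).
- by rewrite distrC; case: (vX y yv).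
- by case: (vX x xv).
- exact: vd.
Qed.

Lemma eq_iter_subdiv_mesh (K : nzRingType) r N n X d (phi phi' : seq V -> K) s :
    bary_closed X -> (size s = n) -> (n <= N)%N ->
    (forall x, x \in s -> X x) -> mesh_le s d ->
    (forall u, size u = n -> (forall x, x \in u -> X x) ->
       mesh_le u ((1 - N%:R^-1) ^+ r * d) -> phi u = phi' u) ->
  iter_subdiv bary r n phi s = iter_subdiv bary r n phi' s.
Proof.
move=> bX szs nN; rewrite /iter_subdiv.
elim: r d s szs => [|r IHr] d s szs sX sd eq_phi.
  by apply: eq_phi; rewrite ?expr0 ?mul1r.
rewrite !iterS; apply: eq_subdiv_mesh bX szs nN sX sd _ => u szu uX ud.
apply: IHr uX ud _ => // v szv vX vd; apply: eq_phi => //.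
by rewrite exprSr -mulrA.
Qed.

End Barycentre.

Lemma bary_map (R : realType) n (A : 'M[R]_n) (s : seq 'rV[R]_n) :
  bary (map (mulmxr A) s) = bary s *m A.
Proof.
rewrite /bary size_map big_map -scalemxAl; congr (_ *: _).
by rewrite mulmx_suml.
Qed.

(** * Vectors in general position *)

Section Generic.
Variables (R : numFieldType).

(** A finite union of proper subspaces is not everything: on the moment curve
    (1, x, x^2, ...) each of them is the zero set of a nonzero polynomial. *)
Lemma generic_vector n (I : finType) (U : I -> 'M[R]_n) :
    (forall i, (\rank (U i) < n)%N) ->
  exists w : 'rV[R]_n, forall i, ~~ (w <= U i)%MS.
Proof.
move=> rkU; pose P i j :=
  \poly_(k < n) (oapp (fun k' => cokermx (U i) k' j) 0 (insub k)).
have /fin_all_exists[j Pj] i : exists j, P i j != 0.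
  have: cokermx (U i) != 0.
    by rewrite -mxrank_eq0 mxrank_coker subn_eq0 -ltnNge.
  move=> cU0; have /existsP[k /existsP[j ckj]] :
      [exists k, exists j, cokermx (U i) k j != 0].
    apply: contraNT cU0; rewrite negb_exists => /forallP c0.
    apply/eqP/matrixP=> k j; rewrite [RHS]mxE; have := c0 k.
    by rewrite negb_exists => /forallP/(_ j); rewrite negbK => /eqP.
  exists j; apply: contraNneq ckj => /(congr1 (fun q : {poly R} => q`_k)).
  by rewrite coef0 coef_poly ltn_ord valK /= => ->.
pose Q := \prod_i P i (j i).
have Q0 : Q != 0 by apply/prodf_neq0 => i _.
have [x Qx] : exists x : R, Q.[x] != 0.
  pose xs : seq R := map (fun k => k%:R) (iota 0 (size Q)).
  have [/allP allQ|] := boolP (all (root Q) xs).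
    have := max_poly_roots Q0 (rs := xs).
    rewrite size_map size_iota ltnn => H; suff: false by [].
    apply: H; first exact/allP.
    rewrite map_inj_uniq ?iota_uniq // => a b /eqP; rewrite eqr_nat; exact/eqP.
  by case/allPn => y _ nr; exists y.
exists (\row_k x ^+ k) => i; apply: contra Qx => /submxP[D wE].
have: (\row_k x ^+ k) *m cokermx (U i) = 0.
  by rewrite wE -mulmxA mulmx_coker mulmx0.
move/matrixP/(_ 0 (j i)); rewrite !mxE => Pi0.
rewrite horner_prod (bigD1 i) //= horner_poly.
rewrite (_ : \sum_(_ < n) _ = 0) ?mul0r //.
rewrite -[RHS]Pi0; apply: eq_bigr => k _; rewrite valK mxE mulrC //.
Qed.

Definition frame_mx n k (I : Type) (B : I -> 'M[R]_n) (w : nat -> 'rV[R]_n)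
  (c : 'I_k -> I) : 'M[R]_(k, n) := \matrix_(i < k) (w i *m B (c i)).

(** The vectors are chosen one after the other: the new one only has to avoid,
    for each choice [c] of matrices, the preimage under one [B b] of the span of
    the previous ones, and there are finitely many such subspaces, all proper
    since k < n. *)
Lemma generic_frame n k (I : finType) (B : I -> 'M[R]_n) :
    (k <= n)%N -> (forall b, B b \in unitmx) ->
  exists w : nat -> 'rV[R]_n, forall c : 'I_k -> I, row_free (frame_mx B w c).
Proof.
move=> le_kn uB; elim: k le_kn => [|k IHk] lt_kn.
  by exists (fun=> 0) => c; rewrite /row_free -leqn0 rank_leq_row.
have [w wP] := IHk (ltnW lt_kn).
have [|v vP] := @generic_vector n ({ffun 'I_k -> I} * I)%type
    (fun cb => <<frame_mx B w cb.1 *m invmx (B cb.2)>>%MS).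
  move=> cb; rewrite mxrank_gen; apply: leq_ltn_trans lt_kn.
  exact: rank_leq_row.
exists (fun i => if i == k then v else w i) => c.
pose c1 (i : 'I_k) := c (widen_ord (leqnSn k) i).
apply: inj_row_free => u; rewrite mulmx_sum_row big_ord_recr /= !rowK /= eqxx.
pose u' := \row_(i < k) u 0 (widen_ord (leqnSn k) i).
rewrite [X in X + _](_ : _ = u' *m frame_mx B w c1); last first.
  rewrite mulmx_sum_row; apply: eq_bigr => i _; rewrite !rowK /= mxE.
  by rewrite ltn_eqF.
move=> u0; have uk0 : u 0 ord_max = 0.
  apply/eqP; apply: contraT => uk0.
  have := vP ([ffun i => c1 i], c ord_max); rewrite genmxE => /negP[].
  apply/submxP; exists (- (u 0 ord_max)^-1 *: u').
  rewrite -scalemxAl mulmxA.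
  have -> : frame_mx B w [ffun i => c1 i] = frame_mx B w c1.
    by apply/row_matrixP => i; rewrite !rowK ffunE.
  move/eqP: u0; rewrite addr_eq0 => /eqP ->.
  rewrite mulNmx scaleNr scalerN opprK -scalemxAl mulmxK ?uB //.
  by rewrite scalerA mulVf // scale1r.
move: u0; rewrite uk0 scale0r addr0 => u'M0.
have /rowP u'0 : u' = 0 by apply: (row_free_inj (wP c1)); rewrite mul0mx.
apply/rowP => i; rewrite mxE.
have [j ->|->] := unliftP ord_max i; last exact: uk0.
have := u'0 j; rewrite !mxE => <-; congr (u 0 _); apply: val_inj.
by rewrite /= /bump leqNgt ltn_ord.
Qed.

End Generic.

Lemma norm_coord_le (R : realType) n (v : 'rV[R]_n) i : `|v 0 i| <= `|v|.
Proof.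
rewrite [leRHS]/Num.norm /= mx_normrE.
exact: (le_bigmax _ (fun ij : 'I_1 * 'I_n => `|v ij.1 ij.2|) (0, i)).
Qed.

Lemma norm_mulmx_le (R : realType) n (v : 'rV[R]_n) (u : 'cV[R]_n) :
  `|(v *m u) 0 0| <= `|v| * \sum_i `|u i 0|.
Proof.
rewrite mxE mulr_sumr; apply: le_trans (ler_norm_sum _ _ _) _.
by apply: ler_sum => i _; rewrite normrM ler_wpM2r // norm_coord_le.
Qed.

Lemma bary_closed_halfspace (R : realType) n (u : 'cV[R]_n) :
  bary_closed (fun v : 'rV[R]_n => 1 <= (v *m u) 0 0).
Proof.
move=> s s0 su; have sz0 : (0 < size s)%N by rewrite lt0n size_eq0.
rewrite /bary -scalemxAl mxE mulmx_suml summxE.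
rewrite ler_pdivlMl ?ltr0n // mulr1.
have -> : (size s)%:R = \sum_(v <- s) (1 : R).
  by rewrite big_const_seq count_predT iter_addr_0.
by rewrite big_seq [leRHS]big_seq; apply: ler_sum.
Qed.

(** The simplices spanned by [generic_frame] stay in a compact annulus.  Linear
    independence provides, for each choice [c], a functional [u c] equal to 1 at
    all vertices; the half-space where [u c] is at least 1 is convex and does
    not come close to 0, uniformly since there are finitely many choices. *)
Lemma generic_simplices (R : realType) n k (I : finType) (B : I -> 'M[R]_n) :
    (k <= n)%N -> (forall b, B b \in unitmx) ->
  exists (w : nat -> 'rV[R]_n) (e M : R), 0 < e /\
    forall c : 'I_k -> I, exists X : 'rV[R]_n -> Prop,
    [/\ bary_closed X, forall i : 'I_k, X (w i *m B (c i)) &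
        forall v, X v -> e <= `|v| <= M].
Proof.
move=> le_kn uB; have [w wP] := generic_frame le_kn uB.
pose M : R := \sum_(i < k) \sum_b `|w i *m B b|.
pose u (c : {ffun 'I_k -> I}) : 'cV[R]_n :=
  pinvmx (frame_mx B w c) *m const_mx 1.
pose S : R := 1 + \sum_c \sum_i `|u c i 0|.
have S0 : 0 < S.
  by rewrite /S ltr_pwDl //; apply: sumr_ge0 => c _; exact: sumr_ge0.
exists w, S^-1, M; split=> [|c0]; first by rewrite invr_gt0.
pose c := [ffun i => c0 i].
exists (fun v => 1 <= (v *m u c) 0 0 /\ `|v - 0| <= M); split=> [|i|v [uv]].
- apply: bary_closedI; first exact: bary_closed_halfspace.
  exact: bary_closed_ball.
- have -> : w i *m B (c0 i) = row i (frame_mx B w c) by rewrite rowK ffunE.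
  split; first by rewrite -row_mul /u mulmxA mulmxVp ?wP // mul1mx !mxE.
  rewrite subr0 rowK /M (bigD1 i) //= (bigD1 (c i)) //=.
  rewrite -addrA lerDl addr_ge0 ?sumr_ge0 // => j _; exact: sumr_ge0.
rewrite subr0 => ->; rewrite andbT -[leLHS]mul1r ler_pdivrMr //.
apply: le_trans uv _; apply: le_trans (ler_norm _) _.
apply: le_trans (norm_mulmx_le _ _) _; rewrite ler_wpM2l //.
rewrite /S (bigD1 c) //= addrCA lerDl addr_ge0 //.
by apply: sumr_ge0 => c' _; apply: sumr_ge0.
Qed.

(** * Uniform separation and continuity on a compact set *)

Section Compactness.
Variables (R : realType) (V : normedModType R) (Z : set V) (I J : finType).
Variable (H : I -> J -> V -> R).
Hypothesis Z_compact : compact Z.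
Hypothesis H_cont : forall i j x, Z x -> {for x, continuous (H i j)}.

(** The index [i] cannot be chosen continuously, but a margin valid at one
    point for its own [i] remains, halved, valid at nearby points, and
    finitely many margins suffice. *)
Lemma compact_margin :
    (forall x, Z x -> exists i, forall a b, a != b -> H i a x != H i b x) ->
  exists2 d, 0 < d & forall x, Z x ->
    exists i, forall a b, a != b -> d <= `|H i a x - H i b x|.
Proof.
move=> H_sep; have /compact_near_coveringP near_Z := Z_compact.
have : \forall d \near 0^'+, Z `<=` [set x | exists i, forall a b,
    a != b -> d <= `|H i a x - H i b x|].
  apply: near_Z => x Zx; have [i sep_i] := H_sep x Zx.
  suff: \forall x' \near x & d \near 0^'+, forall a b,
      a != b -> d <= `|H i a x' - H i b x'|.
    apply: (@filterS _ (filter_prod (nbhs x) 0^'+)) => -[x' d] /= sep_ab.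
    by exists i.
  apply: (@filter_forall _ _ _ (filter_prod (nbhs x) 0^'+)) => a.
  apply: (@filter_forall _ _ _ (filter_prod (nbhs x) 0^'+)) => b.
  have [->|ab] := eqVneq a b; first by apply: nearW => -[].
  pose c := `|H i a x - H i b x|.
  have c0 : 0 < c by rewrite normr_gt0 subr_eq0 sep_i.
  exists ([set x' | c / 2 < `|H i a x' - H i b x'|], [set d | d < c / 2]) => /=.
    split; last by apply: nbhs_right_lt; rewrite divr_gt0.
    have : `|H i a x' - H i b x'| @[x' --> x] --> c.
      by apply: cvg_norm; apply: cvgB; apply: H_cont.
    by move/cvgr_gt; apply; lra.
  by move=> [x' d] /= [lt_c lt_d] _; apply: ltW; apply: lt_trans lt_d _.
move=> near_d; near (0 : R)^'+ => d.
exists d; first by near: d; exact: nbhs_right_gt.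
by near: d.
Unshelve. all: end_near.
Qed.

Lemma compact_modulus (e : R) : 0 < e ->
  exists2 d, 0 < d & forall x y, Z x -> Z y -> `|x - y| <= d ->
    forall i a, `|H i a x - H i a y| < e.
Proof.
move=> e0; have /compact_near_coveringP near_Z := Z_compact.
have : \forall d \near 0^'+, Z `<=` [set x | forall y, `|x - y| <= d ->
    forall i a, `|H i a x - H i a y| < e].
  apply: near_Z => x Zx.
  have : \forall y \near x, forall i a, `|H i a x - H i a y| < e / 2.
    apply: filter_forall => i; apply: filter_forall => a.
    move: (H_cont (i := i) (j := a) Zx) => /cvgrPdist_lt/(_ (e / 2)).
    by apply; rewrite divr_gt0.
  move/nbhs_ballP => [r /= r0 ball_r].
  exists (ball x (r / 2), [set d | d < r / 2]) => /=.
    split; first by apply: nbhsx_ballx; rewrite divr_gt0.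
    by apply: nbhs_right_lt; rewrite divr_gt0.
  move=> [z d] /= [xz dr] y zy i a.
  have xz' : `|x - z| < r / 2 by move: xz; rewrite -ball_normE.
  have Hz : `|H i a x - H i a z| < e / 2.
    apply: ball_r; rewrite -ball_normE /=; apply: lt_trans xz' _; lra.
  have Hy : `|H i a x - H i a y| < e / 2.
    apply: ball_r; rewrite -ball_normE /=.
    by apply: le_lt_trans (ler_distD z _ _) _; lra.
  apply: le_lt_trans (ler_distD (H i a x) _ _) _.
  by rewrite (distrC (H i a z)); lra.
move=> near_d; near (0 : R)^'+ => d.
exists d; first by near: d; exact: nbhs_right_gt.
move=> x y Zx Zy xy i a; have : (Z `<=` [set x | forall y, `|x - y| <= d ->
    forall i a, `|H i a x - H i a y| < e]) by near: d.
by move=> /(_ x Zx y xy i a).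
Unshelve. all: end_near.
Qed.

End Compactness.

(** * Radial projection to the unit sphere *)

Section Normalize.
Variables (R : realType).

Definition sqnorm n (v : 'rV[R]_n) := \sum_(i < n) v 0 i ^+ 2.
Definition radial n (v : 'rV[R]_n) := (Num.sqrt (sqnorm v))^-1 *: v.

Lemma sqnorm_gt0 n (v : 'rV[R]_n) : v != 0 -> 0 < sqnorm v.
Proof.
move=> v0; rewrite lt_neqAle sumr_ge0 ?andbT => [|i _]; last exact: sqr_ge0.
apply: contra v0; rewrite eq_sym => /eqP/psumr_eq0P v0.
apply/eqP/rowP => i; rewrite mxE; apply/eqP; rewrite -sqrf_eq0 v0 //.
by move=> j _; apply: sqr_ge0.
Qed.

Lemma radial_sphere n (v : 'rV[R]_n) : v != 0 -> unit_sphere R n (radial v).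
Proof.
move=> /sqnorm_gt0 v0; rewrite /unit_sphere /=.
under eq_bigr do rewrite mxE exprMn.
by rewrite -mulr_sumr exprVn sqr_sqrtr ?ltW // mulVf // gt_eqF.
Qed.

Lemma sqnormE n (v : 'rV[R]_n) : sqnorm v = (v *m v^T) 0 0.
Proof. by rewrite mxE; apply: eq_bigr => i _; rewrite mxE expr2. Qed.

Lemma radial_orthogonal n (A : 'M[R]_n) v : A *m A^T = 1%:M ->
  radial (v *m A) = radial v *m A.
Proof.
move=> AA; rewrite /radial -scalemxAl; congr (_ ^-1 *: _); congr Num.sqrt.
by rewrite !sqnormE trmx_mul !mulmxA -(mulmxA v A) AA mulmx1.
Qed.

Lemma sum_cvg (T : Type) (F : set_system T) n (G : 'I_n -> T -> R) a :
    Filter F -> (forall i, G i x @[x --> F] --> a i) ->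
  \sum_(i < n) G i x @[x --> F] --> \sum_(i < n) a i.
Proof. by move=> FF cG; apply: cvg_big => //; exact: add_continuous. Qed.

Lemma continuous_mulmx n (Q : 'cV[R]_n) :
  continuous (fun y : 'rV[R]_n => (y *m Q) 0 0).
Proof.
move=> y; rewrite /continuous_at mxE; under eq_cvg do rewrite mxE.
apply: (@sum_cvg _ (nbhs y) n (fun i x => x 0 i * Q i 0)) => i.
apply: cvgM; last exact: cvg_cst.
exact: (@coord_continuous R 1 n 0 i y).
Qed.

Lemma continuous_radial n (v : 'rV[R]_n) : v != 0 ->
  {for v, continuous (@radial n)}.
Proof.
rewrite /continuous_at /radial => v0.
apply: (@cvgZ _ _ _ (nbhs v) _ (fun x => (Num.sqrt (sqnorm x))^-1) id);
  last exact: cvg_id.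
apply: cvgV; first by rewrite sqrtr_eq0 -ltNge sqnorm_gt0.
apply: (cvg_comp (@sqnorm n) Num.sqrt); last exact: sqrt_continuous.
apply: (@sum_cvg _ (nbhs v) n (fun i x => x 0 i ^+ 2)) => i.
by apply: cvgM; exact: coord_continuous.
Qed.

Lemma continuous_radial_comp n m (f : 'rV[R]_n -> 'rV[R]_m) v :
    {within unit_sphere R n, continuous f} -> v != 0 ->
  {for v, continuous (f \o @radial n)}.
Proof.
move=> /subspace_continuousP fc v0 U /(fc _ (radial_sphere v0)) U_near.
have near0 : \forall x \near v, x != 0.
  by apply: (cvgr_neq0 (f := id) (F := nbhs v) v) => //; exact: cvg_id.
change (\forall x \near v, U (f (radial x))).
near=> x; have x0 : x != 0 by near: x.
have : unit_sphere R n (radial x) -> U (f (radial x)).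
  near: x; exact: (continuous_radial v0 U_near).
by apply; apply: radial_sphere.
Unshelve. all: end_near.
Qed.

Lemma compact_annulus n (e M : R) :
  compact [set v : 'rV[R]_n | e <= `|v| <= M].
Proof.
apply: bounded_closed_compact.
  exists M; split=> [|x Mx v /= /andP[_ vM]]; first exact: num_real.
  exact/ltW/(le_lt_trans vM).
rewrite (_ : [set _ | _] = (fun v : 'rV[R]_n => `|v|) @^-1` `[e, M]);
  last by apply/seteqP; split=> v /=; rewrite in_itv.
apply: preimage_closed; last exact: itv_closed.
by move=> v _; apply: norm_continuous.
Qed.

End Normalize.

(** * Labels from separated values *)

Section ArgmaxLabel.
Variables (R : realType) (V : Type) (p m : nat).
Variable (H : 'I_m -> 'F_p -> V -> R) (d : R).
Hypothesis d_gt0 : 0 < d.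

Definition separated v i :=
  [forall a, forall b, (a != b) ==> (d <= `|H i a v - H i b v|)].

(** The sign makes the label equivariant: translating the argument of [H] by x
    lowers the maximizing exponent by one, while [shift] raises it.  The default
    value is not a vertex of the join of m copies. *)
Definition argmax_label v : nat * 'F_p :=
  if [pick i | separated v i] is Some i
  then (i : nat, - [arg max_(a > 0) H i a v]%O) else (m, 0).

Lemma separatedP v i a b :
  separated v i -> a != b -> d <= `|H i a v - H i b v|.
Proof. by move=> /forallP/(_ a)/forallP/(_ b)/implyP. Qed.

Lemma argmax_label_lt v :
  (exists i, separated v i) -> ((argmax_label v).1 < m)%N.
Proof.
case=> i sep; rewrite /argmax_label.
by case: pickP => [j _|/(_ i)]; [exact: ltn_ord | rewrite sep].
Qed.

Lemma separated_shift v v' : (forall i a, H i a v' = H i (a + 1) v) ->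
  separated v' =1 separated v.
Proof.
move=> Hv' i; apply/idP/idP => sep; apply/forallP=> a; apply/forallP=> b.
  apply/implyP => ab; have := separatedP (a := a - 1) (b := b - 1) sep.
  by rewrite !Hv' !subrK (inj_eq (addIr _)); apply.
apply/implyP => ab; rewrite !Hv'; apply: separatedP => //.
by rewrite (inj_eq (addIr _)).
Qed.

Lemma argmax_label_shift v v' : (exists i, separated v i) ->
    (forall i a, H i a v' = H i (a + 1) v) ->
  argmax_label v' = shift (argmax_label v).
Proof.
move=> [i0 sep0] Hv'; rewrite /argmax_label (eq_pick (separated_shift Hv')).
case: pickP => [i sep|/(_ i0)]; last by rewrite sep0.
rewrite /shift /=; congr (_, _).
case: (arg_maxP (fun a => H i a v')) => // a1 _ max1.
case: (arg_maxP (fun a => H i a v)) => // a0 _ max0.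
have Heq : H i a0 v = H i (a1 + 1) v.
  apply/eqP; rewrite eq_le; apply/andP; split; last exact: max0.
  by rewrite -[a0](subrK 1) -!Hv'; apply: max1.
have [->|ne] := eqVneq a0 (a1 + 1); first by rewrite opprD subrK.
by have := separatedP sep ne; rewrite Heq subrr normr0 leNgt d_gt0.
Qed.

(** If the values are d apart and move by less than d / 2, their maximum is
    reached at the same place. *)
Lemma argmax_label_close v v' :
    (exists i, separated v i) -> (exists i, separated v' i) ->
    (forall i a, `|H i a v - H i a v'| < d / 2) ->
  (argmax_label v).1 = (argmax_label v').1 -> argmax_label v = argmax_label v'.
Proof.
move=> [i0 sep0] [i1 sep1] close; rewrite /argmax_label.
case: pickP => [i sep|/(_ i0)]; last by rewrite sep0.
case: pickP => [i' sep'|/(_ i1)]; last by rewrite sep1.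
move=> /= /val_inj ii'; rewrite -{i'}ii' in sep' *.
congr (_, - _).
case: (arg_maxP (fun a => H i a v)) => // a _ maxa.
case: (arg_maxP (fun a => H i a v')) => // b _ maxb.
apply/eqP/negPn/negP => ab.
have := separatedP sep ab; have := separatedP sep' ab.
have := close i a; have := close i b.
have := maxa b isT; have := maxb a isT; move=> /= h1 h2.
rewrite !ltr_norml => /andP[c1 c2] /andP[c3 c4].
rewrite distrC (ger0_norm (x := H i b v' - _)) ?subr_ge0 // => h3.
rewrite ger0_norm ?subr_ge0 // => h4; lra.
Qed.

End ArgmaxLabel.

(** * Representations of C_p without fixed vectors *)

Section CyclicRepr.
Variables (R : realType) (p : nat) (gT : finGroupType) (G : {group gT}).
Hypothesis (p_pr : prime p) (oG : #|G| = p).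
Variables (n : nat) (rV : mx_representation R G n).

(** Every nontrivial element of a group of prime order generates it, so a vector
    fixed by one is fixed by all. *)
Lemma repr_fixed0 h (v : 'rV[R]_n) : rfix_mx rV G = 0 ->
  h \in G -> h != 1%g -> v *m rV h = v -> v = 0.
Proof.
move=> fix0 Gh h1 vh; have GE : G :=: <[h]>%g.
  apply/eqP; rewrite eq_sym eqEcard cycle_subG Gh oG /=.
  have : (#[h]%g %| p)%N by rewrite -oG order_dvdG.
  by move=> /(prime_nt_dvdP p_pr) <- //; rewrite order_eq1.
apply/eqP; rewrite -submx0 -fix0; apply/rfix_mxP => y Gy.
have /cycleP[i ->] : y \in <[h]>%g by rewrite -GE.
elim: i => [|i IHi]; first by rewrite repr_mx1 mulmx1.
by rewrite expgS repr_mxM ?groupX // mulmxA vh.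
Qed.

Variables (x : gT).
Hypothesis (Gx : x \in G) (ox : #[x]%g = p).

Lemma iter_repr a (v : 'rV[R]_n) :
  iter a (mulmxr (rV x)) v = v *m rV (x ^+ a)%g.
Proof.
elim: a => [|a IHa]; first by rewrite repr_mx1 mulmx1.
by rewrite iterS IHa /= expgSr repr_mxM ?groupX // mulmxA.
Qed.

Lemma expg_Fp (a : nat) : (x ^+ (a%:R : 'F_p) = x ^+ a)%g.
Proof. by rewrite val_Fp_nat // -{1}ox expg_mod_order. Qed.

Lemma expg_FpS (a : 'F_p) : (x ^+ (a + 1)%R = x * x ^+ a)%g.
Proof. by rewrite -expgS -(expg_Fp a.+1) -natr1 natr_Zp. Qed.

Lemma unit_repr_diff (a b : 'F_p) : rfix_mx rV G = 0 -> a != b ->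
  rV (x ^+ a)%g - rV (x ^+ b)%g \in unitmx.
Proof.
move=> fix0 ab; rewrite -row_free_unit; apply: inj_row_free => v.
rewrite mulmxBr => /subr0_eq vab.
apply: (@repr_fixed0 (x ^+ a * (x ^+ b)^-1)%g) => //.
- by rewrite groupM ?groupV ?groupX.
- apply: contra ab; rewrite -eq_mulgV1 eq_expg_mod_order ox.
  by rewrite !modn_small ?ltn_Fp.
by rewrite repr_mxM ?groupV ?groupX // mulmxA vab repr_mxK ?groupX.
Qed.

(** If all the functionals failed, each [l i] would vanish on some
    y (x^a - x^b) with a <> b, that is, y would be orthogonal to the rows
    l_i (x^a - x^b)^T; in general position these form a basis. *)
Lemma separating_functionals : rfix_mx rV G = 0 ->
  exists l : nat -> 'rV[R]_n, forall y : 'rV[R]_n, y != 0 ->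
    exists i : 'I_n, forall a b : 'F_p, a != b ->
      (y *m (rV (x ^+ a)%g *m (l i)^T)) 0 0 !=
      (y *m (rV (x ^+ b)%g *m (l i)^T)) 0 0.
Proof.
(* The identity on the diagonal makes B a total family of invertible matrices. *)
move=> fix0; pose B (ab : 'F_p * 'F_p) :=
  if ab.1 == ab.2 then 1%:M else (rV (x ^+ ab.1)%g - rV (x ^+ ab.2)%g)^T.
have uB ab : B ab \in unitmx.
  rewrite /B; case: ifPn => [_|ab12]; first exact: unitmx1.
  by rewrite unitmx_tr unit_repr_diff.
have [l lP] := generic_frame (leqnn n) uB; exists l => y y0.
pose h i (a : 'F_p) := (y *m (rV (x ^+ a)%g *m (l i)^T)) 0 0.
have [/existsP[i /forallP sep]|] := boolP [exists i : 'I_n,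
    forall ab : 'F_p * 'F_p, (ab.1 != ab.2) ==> (h i ab.1 != h i ab.2)].
  by exists i => a b ab; have /implyP := sep (a, b); apply.
rewrite negb_exists => /forallP nosep; case/eqP: y0.
have /fin_all_exists[c cP] (i : 'I_n) :
    exists ab : 'F_p * 'F_p, (ab.1 != ab.2) && (h i ab.1 == h i ab.2).
  apply/existsP; have := nosep i; rewrite negb_forall.
  by congr is_true; apply: eq_existsb => ab; rewrite negb_imply negbK.
have := lP c; rewrite row_free_unit => uM.
have My : frame_mx B l c *m y^T = 0.
  apply/row_matrixP => i; rewrite row_mul rowK row0.
  case/andP: (cP i) => /negPf ne /eqP eqh; rewrite /B ne.
  apply: trmx_inj; rewrite !trmx_mul !trmxK trmx0 mulmxBl mulmxBr.
  apply/rowP => j; rewrite ord1 [LHS]mxE [X in _ + X]mxE [RHS]mxE.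
  by rewrite /h in eqh; rewrite eqh subrr.
by apply: trmx_inj; rewrite -(mulKmx uM y^T) My mulmx0 trmx0.
Qed.

End CyclicRepr.

(** * Equivariant maps between spheres *)

Lemma mem_join_simplex (T : eqType) (g : T -> T) w n c y :
    y \in join_simplex g w n c ->
  exists2 i, (i < n)%N & y = iter (c i) g (w i).
Proof.
elim: n => //= n IHn; rewrite inE => /predU1P[->|/IHn[i lti ->]].
  by exists n.
by exists i => //; apply: ltnW.
Qed.

Lemma exists_small_power (R : realType) N (M e : R) : 0 < e ->
  exists r, (1 - N.+1%:R^-1) ^+ r * M <= e.
Proof.
move=> e0; have q1 : `|1 - N.+1%:R^-1 : R| < 1.
  have N0 : 0 < N.+1%:R^-1 :> R by rewrite invr_gt0 ltr0n.
  have N1 : N.+1%:R^-1 <= 1 :> R by rewrite invf_le1 ?ltr0n ?ler1n.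
  move: (_^-1) N0 N1 => t t0 t1.
  by rewrite ger0_norm ?subr_ge0 // gtrBl.
have : (fun r => (1 - N.+1%:R^-1) ^+ r * M) @ \oo --> (0 : R).
  rewrite -(mul0r M); apply: cvgM; last exact: cvg_cst.
  exact: cvg_expr.
move=> /cvgr_lt/(_ e e0) [r _ /(_ r (leqnn r)) lt_e]; exists r; exact: ltW.
Qed.

Theorem corollary4p3 (R : realType) (p : nat) (p_prime : prime p)
    (gT : finGroupType) (G : {group gT})
    (G_cyclic : cyclic G) (G_order : #|G| = p)
    (n m : nat)
    (rV : mx_representation R G n) (rV' : mx_representation R G m)
    (orthV : orthogonal_repr rV) (orthV' : orthogonal_repr rV')
    (fixV : rfix_mx rV G = 0) (fixV' : rfix_mx rV' G = 0)
    (dimVV' : (m < n)%N) :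
  ~ exists f : 'rV[R]_n -> 'rV[R]_m, equivariant_sphere_map rV rV' f.
Proof.
case=> f [f_cont f_sphere f_equiv].
have [x GE] := cyclicP G_cyclic.
have Gx : x \in G by rewrite GE cycle_id.
have ox : #[x]%g = p by rewrite orderE -GE.
pose g := mulmxr (rV x) : 'rV[R]_n -> 'rV[R]_n.
have gE a v : iter a g v = v *m rV (x ^+ a)%g by apply: iter_repr.
have g0 v a : v != 0 -> iter a g v != 0.
  move=> v0; rewrite gE; apply: contra v0 => /eqP vx0.
  by rewrite -(repr_mxK rV (groupX a Gx) v) vx0 mul0mx.
have gp : iter p g =1 id.
  by move=> v; rewrite gE -ox expg_order repr_mx1 mulmx1.
have [l lP] := separating_functionals p_prime G_order Gx ox fixV'.
(* The values of l_i on the orbit of the image of v; sphere maps are extended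
   radially to nonzero vectors. *)
pose H (i : 'I_m) (a : 'F_p) (v : 'rV[R]_n) : R :=
  (f (radial v) *m (rV' (x ^+ a)%g *m (l i)^T)) 0 0.
have H_sep v : v != 0 -> exists i, forall a b, a != b -> H i a v != H i b v.
  move=> v0; apply: lP.
  apply: contra_eq_neq (f_sphere _ (radial_sphere v0)) => ->.
  by rewrite big1 1?eq_sym ?oner_eq0 // => i _; rewrite mxE expr0n.
have H_shift i a v : v != 0 -> H i a (g v) = H i (a + 1) v.
  move=> v0; rewrite /H /= radial_orthogonal; last exact: orthV.
  rewrite f_equiv //; last exact: radial_sphere.
  by rewrite expg_FpS // repr_mxM ?groupX // -!mulmxA.
have H_cont i a v : v != 0 -> {for v, continuous (H i a)}.
  move=> v0; apply: (@continuous_comp _ _ _ (f \o @radial R n)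
    (fun y => (y *m (rV' (x ^+ a)%g *m (l i)^T)) 0 0)).
    exact: continuous_radial_comp.
  exact: continuous_mulmx.
have u_rV (a : 'F_p) : rV (x ^+ a)%g \in unitmx.
  by rewrite repr_mx_unit ?groupX.
have [w [e [M [e0 wP]]]] := generic_simplices dimVV' u_rV.
pose Z : set 'rV[R]_n := [set v | e <= `|v| <= M].
have Z0 v : Z v -> v != 0.
  by move=> /andP[ev _]; rewrite -normr_gt0 (lt_le_trans e0).
have Z_compact : compact Z by apply: compact_annulus.
have [d d0 dP] := compact_margin Z_compact
  (fun i a v Zv => H_cont i a v (Z0 v Zv)) (fun v Zv => H_sep v (Z0 v Zv)).
have [ep ep0 epP] := compact_modulus Z_compact
  (fun i a v Zv => H_cont i a v (Z0 v Zv)) (divr_gt0 d0 (ltr0n R 2)).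
(* Two vertices of a simplex are at most M + M apart. *)
have [r rP] := exists_small_power m (M + M) ep0.
have Z_sep v : Z v -> exists i, separated H d v i.
  move=> /dP[i sep]; exists i; apply/forallP=> a; apply/forallP=> b.
  by apply/implyP/sep.
apply: (@no_equivariant_labelling p p_prime 'rV[R]_n g (@bary R _) w
  (argmax_label H d) m r gp).
  exact: bary_map.
move=> k c phi phi' le_km eq_phi.
have [X [bX wX XZ]] := wP (fun i => (c i)%:R).
have vtxX v : v \in join_simplex g w k c -> X v.
  move=> /mem_join_simplex[i lti ->].
  have := wX (Ordinal (leq_trans lti le_km)).
  by rewrite /= gE expg_Fp.
apply: (@eq_iter_subdiv_mesh R _ _ r m.+1 k X (M + M)) => //.
- exact: size_join_simplex.
- move=> y z /vtxX/XZ/andP[_ yM] /vtxX/XZ/andP[_ zM].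
  by apply: le_trans (ler_normB _ _) _; apply: lerD.
move=> s szs sX sd; apply: eq_phi => //; split=> [y /sX/XZ Zy|y z ys zs].
  split; first by apply: argmax_label_lt; apply: Z_sep.
  elim=> // a IHa; rewrite !iterS -IHa.
  have y0 : iter a g y != 0 by rewrite g0 ?Z0.
  apply: argmax_label_shift => // [|i b]; last exact: H_shift.
  (* Translates of y may leave Z, but separation is invariant. *)
  elim: a {IHa y0} => [|a [i sep]]; first exact: Z_sep.
  exists i; rewrite (@separated_shift _ _ _ _ H d (iter a g y)) // => i' b.
  by rewrite iterS H_shift ?g0 ?Z0.
have [Zy Zz] : Z y /\ Z z by split; apply: XZ; apply: sX.
have yz : `|y - z| <= ep by apply: le_trans rP; apply: sd.
exact: argmax_label_close (Z_sep y Zy) (Z_sep z Zz) (epP y z Zy Zz yz).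
Qed.
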